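(* Let $d\in\mathbb N$. There are constants $\varepsilon_0(d)>0$ and $c(d)>0$, depending only on $d$, such that for any $\varepsilon\in(0,\varepsilon_0(d))$ and any positive integers $n_1,\ldots,n_d$, with $N:=n_1n_2\cdots n_d$, there is a set of signum tensors $\mathcal S^*\subset\{-1,1\}^{n_1\times n_2\times\cdots\times n_d}$ of cardinality $$|\mathcal S^*|\ge2^N-2^{N c(d)\,\varepsilon\log(1/\varepsilon)}$$ with the following property. If a tensor $T\in\mathbb R^{n_1\times\cdots\times n_d}$ has $\operatorname{sign}T\in\mathcal S^*$, then $$\inf_{\operatorname{rank}\widetilde T\le\varepsilon N/\max_j\{n_j\}}\|T-\widetilde T\|_{\ell_1^N}\ge\varepsilon N\min_{i_1,\ldots,i_d}|T_{i_1,\ldots,i_d}|.$$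
   Context: A tensor is an array $T\in\mathbb R^{n_1\times\cdots\times n_d}$ with entries $T_{i_1,\ldots,i_d}$, $1\le i_j\le n_j$. A nonzero tensor has rank $1$ if $T_{i_1,\ldots,i_d}=u^1_{i_1}u^2_{i_2}\cdots u^d_{i_d}$ for some vectors $u^j\in\mathbb R^{n_j}$; the rank of a tensor is the minimal number of rank-one tensors summing to it (the zero tensor has rank $0$). A signum tensor is a tensor with all entries in $\{-1,1\}$. $\operatorname{sign}T$ is the entrywise sign, with $\operatorname{sign}0=0$. $\|T\|_{\ell_1^N}=\sum_{i_1,\ldots,i_d}|T_{i_1,\ldots,i_d}|$. The infimum is over tensors $\widetilde T\in\mathbb R^{n_1\times\cdots\times n_d}$. *)

(* Defs.v *)
From HB Require Import structures.
From mathcomp Require Import all_boot all_order all_algebra.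
From mathcomp Require Import finmap.
From mathcomp Require Import all_classical all_reals all_analysis.

Set Implicit Arguments.
Unset Strict Implicit.
Unset Printing Implicit Defensive.

Import Order.TTheory GRing.Theory Num.Theory.

Local Open Scope classical_set_scope.
Local Open Scope ring_scope.

(* Indices are 0-based: the j-th component of a multi-index is in 'I_(n j). *)
Notation tindex n := {dffun forall j, 'I_(n j)}.

Notation tensor R n := {ffun tindex n -> R}.

Section Tensors.
Variables (R : realType) (d : nat) (n : 'I_d -> nat).
Implicit Type T : tensor R n.

Definition rank_one T : Prop :=
  T != 0 /\
  exists u : forall j : 'I_d, 'I_(n j) -> R,
    forall i : tindex n, T i = \prod_(j < d) u j (i j).

Definition sum_of_rank_one (r : nat) T : Prop :=
  exists F : 'I_r -> tensor R n,
    (forall k, rank_one (F k)) /\ T = \sum_(k < r) F k.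

(* The default value 0 is only reached for d = 0, where the empty product
   makes 1 the only rank-one tensor; see tensor_rankP. *)
Definition tensor_rank T : nat :=
  xget 0%N [set r : nat | sum_of_rank_one r T /\
                          forall s : nat, sum_of_rank_one s T -> (r <= s)%N].

Definition signum_tensor T : Prop := forall i, T i = -1 \/ T i = 1.

Definition tensor_sign T : tensor R n := [ffun i => Num.sg (T i)].

Definition l1norm T : R := \sum_i `|T i|.

(* An infimum over finitely many values, hence a minimum as soon as all
   dimensions are positive; see min_abs_entryP. *)
Definition min_abs_entry T : R := inf (range (fun i => `|T i|)).

Lemma sum_of_rank_one_exists T : (0 < d)%N -> exists r, sum_of_rank_one r T.
Proof.
move=> d0; pose A := [set i : tindex n | T i != 0]%SET.
exists #|A|, (fun k => [ffun i => if i == enum_val k then T i else 0]); split.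
- move=> k; set e := enum_val k.
  have Te : T e != 0 by have := enum_valP k; rewrite inE.
  split.
    apply/eqP => /ffunP /(_ e); rewrite !ffunE eqxx => T0.
    by rewrite T0 eqxx in Te.
  exists (fun j a => (a == e j)%:R * (if j == Ordinal d0 then T e else 1)).
  move=> i; rewrite ffunE big_split /= -big_mkcond big_pred1_eq.
  case: eqVneq => [->|ne]; first by rewrite big1 ?mul1r // => j _; rewrite eqxx.
  have [j ij] : exists j, i j != e j.
    apply/existsP; apply: contraNT ne => /existsPn ie.
    by apply/eqP/ffunP => j; apply/eqP; have := ie j; rewrite negbK.
  by rewrite (bigD1 j) //= (negbTE ij) !mul0r.
- apply/ffunP => i; rewrite sum_ffunE.
  under eq_bigr do rewrite ffunE.
  rewrite -(big_enum_val (fun e => if i == e then T i else 0)) /=.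
  rewrite -big_mkcondr /=; have [iA|iA] := boolP (i \in A).
    by rewrite (big_pred1 i) // => j /=; rewrite eq_sym andb_idl // => /eqP ->.
  rewrite big_pred0 => [|j]; first by move: iA; rewrite inE negbK => /eqP.
  by apply/negP => /andP[jA /eqP ij]; rewrite ij jA in iA.
Qed.

Lemma tensor_rankP T : (0 < d)%N ->
  sum_of_rank_one (tensor_rank T) T /\
  forall s : nat, sum_of_rank_one s T -> (tensor_rank T <= s)%N.
Proof.
move=> d0; rewrite /tensor_rank; case: xgetP => [r _ //|no_min].
have exT : exists r, `[< sum_of_rank_one r T >].
  by have [r rT] := sum_of_rank_one_exists T d0; exists r; exact/asboolP.
case: (no_min (ex_minn exT)); case: ex_minnP => r /asboolP rT r_min.
by split=> // s /asboolP /r_min.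
Qed.

Lemma min_abs_entryP T : (forall j, (0 < n j)%N) ->
  (exists i, min_abs_entry T = `|T i|) /\ forall i, min_abs_entry T <= `|T i|.
Proof.
move=> n0; pose i0 : tindex n := [ffun j => Ordinal (n0 j)].
have lbT i : min_abs_entry T <= `|T i|.
  by apply: ge_inf; [exists 0 => _ [j _ <-] | exists i].
split=> //.
have [//|i _ i_min] := @Order.TotalTheory.arg_minP _ _ _ i0 xpredT (fun i => `|T i|).
exists i; apply/eqP; rewrite eq_le lbT /=.
by apply: lb_le_inf; [exists `|T i0|, i0 | move=> _ [j _ <-]; exact: i_min].
Qed.

End Tensors.

(* Main.v *)
Require Import Defs.
From HB Require Import structures.
From mathcomp Require Import all_boot all_order all_algebra.
From mathcomp Require Import finmap.
From mathcomp Require Import all_classical all_reals all_analysis.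
From mathcomp Require Import ring lra zify.

Import Order.TTheory GRing.Theory Num.Theory.
Import numFieldNormedType.Exports.

Local Open Scope fset_scope.
Local Open Scope classical_set_scope.
Local Open Scope ring_scope.

(** If the sign of [T] is [sigma] and some [T'] of small rank satisfies
    [l1norm (T - T') < eps * N * min_abs_entry T], then the sign pattern of [T']
    differs from [sigma] in fewer than [eps * N] entries, because each such entry
    contributes at least [min_abs_entry T] to the norm ([mismatch_le_l1norm]).  So
    the sign tensors to discard are those within Hamming distance [eps * N] of a sign
    pattern of a tensor of rank at most [r = eps * N / max n_j].  The entries of such
    a tensor are polynomials of degree [d] in [k = r * sum n_j <= d * eps * N]
    variables, and what has to be bounded is the number of sign patterns of [N] real
    polynomials in [k] variables.

    The bound is of Warren's type: [m] polynomials of degree at most [D] in [k]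
    variables realize at most [A * (2 * D + 1) ^ k] sign patterns, where [A] is the
    number of subsets of size at most [k] of a set of size [2 * m]
    ([card_sign_patterns]).  In each realized sign cell, cut out by
    [t_j <= +- f_j], one minimizes a coercive sum of even powers of the coordinates
    plus a large multiple of the squared violations of the inequalities.  The
    minimizer still lies in the open cell, hence determines the sign pattern, and
    near it the function minimized is dominated by a polynomial that depends only on
    the set [B] of active signed constraints ([cell_critical_point]).  Two facts
    finish the count.
    - For suitable thresholds [t_j] at most [k] constraints are active anywhere
      ([generic_thresholds], [uniform_gap]): if some [k + 1] of the
      [|f_j|] attained simultaneously all [L ^ (k + 1)] combinations of [L] given
      values, there would be as many linearly independent polynomials of degree
      [O (L)] in [k] variables, while these form a space of dimension [O (L ^ k)].
    - For a fixed [B], the minimizers are critical points of a polynomial whose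
      leading part is a sum of pure powers: they satisfy [x_i ^ (2 D + 1) = g_i x]
      with [g_i] of degree at most [2 D].  These relations reduce every monomial to
      one with all exponents at most [2 D], so functions on the set of solutions form
      a space of dimension at most [(2 D + 1) ^ k] ([card_critical_le]).

    The numerical estimate then weighs subsets [B] by [eps ^ #|B|]: at most
    [eps ^ (- K) * (1 + eps) ^ M] subsets of an [M]-element set have size at most
    [K] ([card_small_subsets]), which produces the factor
    [eps * ln (1 / eps)] in the exponent ([near_low_rank_bound]). *)

(** * Polynomial functions *)

(** [n] is only an upper bound for the total degree. *)
Inductive polfun (R : realType) (k : nat) : nat -> ('rV[R]_k -> R) -> Prop :=
| polfun_cst c : polfun R k 0 (fun=> c)
| polfun_coord i : polfun R k 1 (fun x => x 0 i)
| polfun_add n f g :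
    polfun R k n f -> polfun R k n g -> polfun R k n (fun x => f x + g x)
| polfun_mul n m f g : polfun R k n f -> polfun R k m g ->
    polfun R k (n + m) (fun x => f x * g x)
| polfun_widen n m f : (n <= m)%N -> polfun R k n f -> polfun R k m f.

Arguments polfun {R k}.

Section PolynomialFunctions.
Context {R : realType} {k : nat}.
Implicit Types f g : 'rV[R]_k -> R.

Lemma polfun_scale n c f : polfun n f -> polfun n (fun x => c * f x).
Proof. by move=> pf; rewrite -[n]add0n; apply: polfun_mul => //; apply: polfun_cst. Qed.

Lemma polfun_sub n f g :
  polfun n f -> polfun n g -> polfun n (fun x => f x - g x).
Proof.
move=> pf pg; under eq_fun do rewrite -mulN1r.
by apply: polfun_add => //; exact: polfun_scale.
Qed.

Lemma polfun_addc n c f : polfun n f -> polfun n (fun x => f x + c).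
Proof.
move=> pf; apply: polfun_add => //.
exact: polfun_widen (leq0n n) (polfun_cst _ _ c).
Qed.

Lemma polfun_exp n a f : polfun n f -> polfun (a * n)%N (fun x => f x ^+ a).
Proof.
move=> pf; elim: a => [|a IHa].
  by rewrite mul0n; under eq_fun do rewrite expr0; exact: polfun_cst.
by rewrite mulSn; under eq_fun do rewrite exprS; exact: polfun_mul.
Qed.

Lemma polfun_sum (I : Type) (r : seq I) (P : pred I) n (F : I -> 'rV[R]_k -> R) :
  (forall i, polfun n (F i)) -> polfun n (fun x => \sum_(i <- r | P i) F i x).
Proof.
move=> pF; elim: r => [|i r IHr].
  under eq_fun do rewrite big_nil.
  exact: polfun_widen (leq0n n) (polfun_cst _ _ 0).
under eq_fun do rewrite big_cons.
by case: (P i) => //; apply: polfun_add.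
Qed.

Lemma polfun_prod (I : finType) (P : pred I) n (F : I -> 'rV[R]_k -> R) :
  (forall i, polfun n (F i)) ->
  polfun (#|I| * n)%N (fun x => \prod_(i | P i) F i x).
Proof.
move=> pF; have -> : #|I| = size (index_enum I) by rewrite -sum1_size -sum1_card.
elim: (index_enum I) => [|i r IHr].
  by under eq_fun do rewrite big_nil; exact: polfun_cst.
under eq_fun do rewrite big_cons; rewrite mulSn.
case: (P i); first exact: polfun_mul.
by apply: polfun_widen IHr; exact: leq_addl.
Qed.

Lemma polfun_monomial (e : 'I_k -> nat) :
  polfun (\sum_i e i)%N (fun x : 'rV[R]_k => \prod_i x 0 i ^+ e i).
Proof.
suff H r : polfun (\sum_(i <- r) e i)%N
    (fun x : 'rV[R]_k => \prod_(i <- r) x 0 i ^+ e i).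
  exact: H.
elim: r => [|i r IHr].
  by rewrite big_nil; under eq_fun do rewrite big_nil; exact: polfun_cst.
have -> : (fun x : 'rV[R]_k => \prod_(j <- i :: r) x 0 j ^+ e j) =
          fun x => x 0 i ^+ e i * \prod_(j <- r) x 0 j ^+ e j.
  by apply/funext => x; rewrite big_cons.
rewrite big_cons; apply: polfun_mul => //.
by rewrite -{1}[e i]muln1; apply: polfun_exp; exact: polfun_coord.
Qed.

(** Polynomial functions of degree at most [n] are spanned by the monomials of degree
    at most [n].  In the case of a product [f * g], the functions [f] such that
    [f * g] lies in [Q] again form a space, so that the induction hypotheses can be
    used one factor at a time. *)
Lemma polfun_span n f (Q : ('rV[R]_k -> R) -> Prop) : polfun n f ->
  (forall g h, Q g -> Q h -> Q (fun x => g x + h x)) ->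
  (forall c g, Q g -> Q (fun x => c * g x)) ->
  (forall e : 'I_k -> nat, (\sum_i e i <= n)%N ->
     Q (fun x => \prod_i x 0 i ^+ e i)) ->
  Q f.
Proof.
move=> pf; elim: pf Q => {n f}
  [c|i|n f g pf IHf pg IHg|n m f g pf IHf pg IHg|n m f nm pf IHf] Q QD QZ Qe.
- have := QZ c _ (Qe (fun=> 0%N) _); rewrite big1 // => /(_ isT).
  by under eq_fun do rewrite big1 // mulr1.
- have -> : (fun x : 'rV[R]_k => x 0 i) = fun x => \prod_j x 0 j ^+ (j == i).
    apply/funext => x; rewrite (bigD1 i) //= eqxx expr1 big1 ?mulr1 // => j /negbTE ->.
    by rewrite expr0.
  by apply: Qe; rewrite (bigD1 i) //= eqxx big1 // => j /negbTE ->.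
- by apply: (QD); [exact: (IHf _ QD QZ Qe)|exact: (IHg _ QD QZ Qe)].
- apply: (IHf (fun f => Q (fun x => f x * g x))) => [f1 f2 Q1 Q2|c f1 Q1|e en].
  + by under eq_fun do rewrite mulrDl; exact: QD.
  + by under eq_fun do rewrite -mulrA; exact: QZ.
  apply: (IHg (fun g => Q (fun x => (\prod_i x 0 i ^+ e i) * g x)))
    => [g1 g2 Q1 Q2|c g1 Q1|e' en'].
  + by under eq_fun do rewrite mulrDr; exact: QD.
  + by under eq_fun do rewrite mulrCA; exact: QZ.
  under eq_fun do rewrite -big_split /=.
  under eq_fun do under eq_bigr do rewrite -exprD.
  by apply: Qe; rewrite big_split leq_add.
- by apply: IHf => // e en; apply: Qe; exact: leq_trans nm.
Qed.

Lemma polfun_continuous n f : polfun n f -> continuous f.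
Proof.
elim=> {n f} [c|i|n f g _ cf _ cg|n m f g _ cf _ cg|//] x.
- exact: cst_continuous.
- exact: coord_continuous.
- by apply: continuousD; [exact: cf|exact: cg].
- by apply: continuousM; [exact: cf|exact: cg].
Qed.

(** On a coordinate line [f] is a univariate polynomial, whose linear coefficient is
    the value of the partial derivative [g]. *)
Lemma polfun_line n f i : polfun n f -> exists2 g, polfun n g &
  forall x, exists2 q : {poly R},
    forall s, f (x + s *: delta_mx 0 i) = q.[s] & q`_1 = g x.
Proof.
suff H : polfun n f -> exists2 g, polfun n g &
  forall x, exists2 q : {poly R},
    forall s, f (x + s *: delta_mx 0 i) = q.[s] & q`_0 = f x /\ q`_1 = g x.
  move=> /H[g pg gP]; exists g => // x; have [q qP [_ q1]] := gP x.
  by exists q.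
elim=> {n f} [c|j|n f g _ [f' pf fP] pg [g' pg' gP]
             |n m f g pf [f' pf' fP] pg [g' pg' gP]|n m f nm pf [f' pf' fP]].
- exists (fun=> 0) => [|x]; first exact: polfun_cst.
  by exists c%:P => [s|]; rewrite ?hornerC ?coefC.
- exists (fun=> (j == i)%:R) => [|x].
    exact: polfun_widen (leq0n _) (polfun_cst _ _ _).
  exists ((x 0 j)%:P + (j == i)%:R *: 'X) => [s|].
    by rewrite !hornerE !mxE eqxx /= mulrC.
  by rewrite !coefD !coefC !coefZ !coefX !eqxx /= mulr0 mulr1 addr0 add0r.
- exists (fun x => f' x + g' x) => [|x]; first exact: polfun_add.
  have [q qP [q0 q1]] := fP x; have [r rP [r0 r1]] := gP x.
  exists (q + r) => [s|]; first by rewrite hornerD -qP -rP.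
  by rewrite !coefD q0 q1 r0 r1.
- exists (fun x => f x * g' x + f' x * g x) => [|x].
    by apply: polfun_add; apply: polfun_mul.
  have [q qP [q0 q1]] := fP x; have [r rP [r0 r1]] := gP x.
  exists (q * r) => [s|]; first by rewrite hornerM -qP -rP.
  by rewrite !coefM !big_ord_recl !big_ord0 /= !addr0 q0 q1 r0 r1.
- exists f' => //; exact: polfun_widen nm pf'.
Qed.

End PolynomialFunctions.

(** * Counting points by dimension *)

(** If the indicator functions of the points of [X] are combinations of [#|E|]
    functions [phi ^~ e], the identity matrix of size [#|X|] factors through
    dimension [#|E|]. *)
Lemma card_le_of_span (F : fieldType) (X E : finType) (phi : X -> E -> F) :
  (forall p, exists a : E -> F,
     forall p', \sum_e a e * phi p' e = (p == p')%:R) -> (#|X| <= #|E|)%N.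
Proof.
move=> /choice[a aP].
pose A := \matrix_(i < #|X|, j < #|E|) phi (enum_val i) (enum_val j).
pose B := \matrix_(j < #|E|, i < #|X|) a (enum_val i) (enum_val j).
apply: (@mulmx1_min _ _ _ A B); apply/matrixP => i j; rewrite !mxE.
rewrite eq_sym -(inj_eq enum_val_inj) -aP.
rewrite [RHS](reindex_onto enum_val enum_rank) /= => [|e _]; last first.
  by rewrite enum_rankK.
by apply: eq_big => l; rewrite ?enum_valK ?eqxx // !mxE mulrC.
Qed.

Section PolynomialDimension.
Context {R : realType} {k : nat} {X : finType} (pts : X -> 'rV[R]_k).
Implicit Types f g : 'rV[R]_k -> R.

(** On the points of [X], [f] is a combination of monomials with all exponents below
    [q]; there are [q ^ k] of these. *)
Definition box_spanned (q : nat) f : Prop := exists a : {ffun 'I_k -> 'I_q} -> R,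
  forall p, f (pts p) = \sum_e a e * \prod_i pts p 0 i ^+ e i.

Lemma box_spanned_add q f g :
  box_spanned q f -> box_spanned q g -> box_spanned q (fun x => f x + g x).
Proof.
move=> [a aP] [b bP]; exists (fun e => a e + b e) => p; rewrite aP bP -big_split.
by apply: eq_bigr => e _; rewrite mulrDl.
Qed.

Lemma box_spanned_scale q c f : box_spanned q f -> box_spanned q (fun x => c * f x).
Proof.
move=> [a aP]; exists (fun e => c * a e) => p; rewrite aP mulr_sumr.
by apply: eq_bigr => e _; rewrite mulrA.
Qed.

Lemma box_spanned_monomial q (e : 'I_k -> nat) : (forall i, e i < q)%N ->
  box_spanned q (fun x => \prod_i x 0 i ^+ e i).
Proof.
move=> eq; pose e0 : {ffun 'I_k -> 'I_q} := [ffun i => Ordinal (eq i)].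
exists (fun e' => (e' == e0)%:R) => p.
rewrite [RHS](bigD1 e0) //= eqxx mul1r [X in _ + X]big1 ?addr0 => [|e' /negbTE ->].
  by apply: eq_bigr => i _; rewrite ffunE.
exact: mul0r.
Qed.

(** The hypothesis on [G] says that its members are nonzero multiples of the indicator
    functions of the points, so the monomials span all functions on [X]. *)
Lemma card_points_le q (G : X -> 'rV[R]_k -> R) :
  (forall p, box_spanned q (G p)) ->
  (forall p p', (G p (pts p') != 0) = (p == p')) -> (#|X| <= q ^ k)%N.
Proof.
move=> Gq GP; rewrite -[X in (_ ^ X)%N]card_ord -[X in (X ^ _)%N]card_ord -card_ffun.
apply: (@card_le_of_span R _ _
  (fun p (e : {ffun 'I_k -> 'I_q}) => \prod_i pts p 0 i ^+ e i)) => p.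
have [a aP] := box_spanned_scale _ (G p (pts p))^-1 _ (Gq p).
exists a => p'; rewrite -aP; have [<-|pp'] := eqVneq p p'.
  by rewrite mulVf // GP.
by move: (GP p p'); rewrite (negbTE pp') => /negbFE/eqP ->; rewrite mulr0.
Qed.

Lemma card_separated_le n (G : X -> 'rV[R]_k -> R) :
  (forall p, polfun n (G p)) ->
  (forall p p', (G p (pts p') != 0) = (p == p')) -> (#|X| <= n.+1 ^ k)%N.
Proof.
move=> pG; apply: card_points_le => p.
apply: (polfun_span _ _ _ (pG p)) => [||e en].
- exact: box_spanned_add.
- exact: box_spanned_scale.
apply: box_spanned_monomial => i.
by rewrite ltnS (leq_trans _ en) // (bigD1 i) ?leq_addr.
Qed.

(** The witness is the product of the squared distances to the other points. *)
Lemma interpolation : injective pts -> exists n (G : X -> 'rV[R]_k -> R),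
  (forall p, polfun n (G p)) /\ forall p p', (G p (pts p') != 0) = (p == p').
Proof.
move=> ptsI; pose d (p' : X) (x : 'rV[R]_k) : R := \sum_i (x 0 i - pts p' 0 i) ^+ 2.
exists (#|X| * (2 * 1))%N, (fun p x => \prod_(p' | p' != p) d p' x); split=> [p|p p'].
  apply: polfun_prod => p'; rewrite /d; apply: polfun_sum => i; apply: polfun_exp.
  exact: (polfun_addc _ _ _ (polfun_coord _ _ i)).
have d0 q q' : (d q (pts q') == 0) = (q == q').
  rewrite psumr_eq0 => [|i _]; last exact: sqr_ge0.
  apply/allP/eqP => [dq|-> i _]; last by rewrite subrr expr0n /=.
  apply: ptsI; apply/rowP => i; have /= := dq i (mem_index_enum _).
  by rewrite sqrf_eq0 subr_eq0 => /eqP.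
apply/prodf_neq0/eqP => [h|<- q qp]; last by rewrite d0.
by apply/eqP; apply: contraT => pp'; have := h p'; rewrite d0 eqxx eq_sym => /(_ pp').
Qed.

(** A Bezout bound for equations with pure leading powers: replacing [x_i ^ q.+1] by
    [g i] in a monomial lowers its total degree, so every polynomial function agrees
    on the solutions with a combination of monomials with exponents at most [q]; by
    interpolation this covers all functions on the solutions. *)
Lemma card_critical_le q (g : 'I_k -> 'rV[R]_k -> R) : injective pts ->
  (forall i, polfun q (g i)) ->
  (forall p i, pts p 0 i ^+ q.+1 = g i (pts p)) -> (#|X| <= q.+1 ^ k)%N.
Proof.
move=> /interpolation[n [G [pG GP]]] pg eqg.
apply: (card_points_le _ _ _ GP) => p; move: (G p) (pG p) => {pG GP}.
elim/ltn_ind: n => n IHn f pf.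
apply: (polfun_span _ _ _ pf) => [||e en].
- exact: box_spanned_add.
- exact: box_spanned_scale.
have [/forallP eq|/forallPn[i]] := boolP [forall i, (e i < q.+1)%N].
  exact: box_spanned_monomial.
rewrite -leqNgt => eiq.
(* [m] is the monomial divided by [x_i ^ q.+1]. *)
pose m (x : 'rV[R]_k) : R := \prod_j x 0 j ^+ (if j == i then (e i - q.+1)%N else e j).
have pm : polfun (\sum_j (if j == i then (e i - q.+1)%N else e j))%N m.
  exact: polfun_monomial.
have [|a aP] := IHn _ _ _ (polfun_mul _ _ _ _ _ _ (pg i) pm).
  rewrite (leq_trans _ en) // (bigD1 i) //= eqxx [in X in (_ < X)%N](bigD1 i) //=.
  rewrite addnA -2!addSn subnKC // leq_add2l leq_sum // => j /negbTE ->.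
  by [].
exists a => p'; rewrite -aP -eqg /m (bigD1 i) //= [in RHS](bigD1 i) //= eqxx.
rewrite mulrA -exprD subnKC //; congr (_ * _).
by apply: eq_bigr => j /negbTE ->.
Qed.

End PolynomialDimension.

(** * Thresholds that few polynomials reach simultaneously *)

Section GenericThresholds.
Context {R : realType} {k : nat} {J : finType} (D : nat) (f : J -> 'rV[R]_k -> R).
Hypothesis pf : forall j, polfun D (f j).

Section Grid.
Context {L : nat} (gr : 'I_L.+1 -> R).
Hypotheses (gr_inj : injective gr) (gr_gt0 : forall a, 0 < gr a).
Implicit Types (S : {set J}) (a : {ffun J -> 'I_L.+1}).

Let bad S a := exists x, forall j, j \in S -> `|f j x| = gr (a j).
Let restr S a := [ffun j => if j \in S then a j else ord0].

(** Choosing a point [x b] that attains the grid values prescribed by [b] on [S], the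
    product of the [f j ^+ 2 - gr c ^+ 2] over [j] in [S] and [c] other than [b j]
    vanishes at all these points except [x b].  Squares remove the absolute values. *)
Let card_bad_restr S :
  (#|restr S @: [set a | `[< bad S a >]]%SET|
     <= (#|J| * (L.+1 * (2 * D))).+1 ^ k)%N.
Proof.
set B := _ @: _; rewrite -[#|B|]card_sig.
have /choice[x xP] : forall b : {b | b \in B}, exists x,
    forall j, j \in S -> `|f j x| = gr (val b j).
  case=> b /= /imsetP[a]; rewrite inE => /asboolP[x xa] ->.
  by exists x => j jS; rewrite ffunE jS; exact: xa.
pose G (b : {b | b \in B}) y : R := \prod_(j in S) \prod_(c | c != val b j)
  (f j y ^+ 2 - gr c ^+ 2).
apply: (card_separated_le x _ G) => [b|b b'].
  rewrite /G -[X in (_ * (X * _))%N]card_ord.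
  apply: polfun_prod => j; apply: polfun_prod => c.
  exact: polfun_addc (polfun_exp _ _ _ (pf j)).
have fgr j c : j \in S -> (f j (x b') ^+ 2 - gr c ^+ 2 == 0) = (c == val b' j).
  move=> jS; rewrite subr_eq0 -[f j _ ^+ 2]real_normK ?num_real // xP //.
  by rewrite eqrXn2 ?ltW // (inj_eq gr_inj) eq_sym.
apply/prodf_neq0/eqP => [h|-> j jS].
  apply/val_inj/ffunP => j; have [jS|jS] := boolP (j \in S); last first.
    by case: b b' {h fgr} => b /= /imsetP[a _ ->] [b' /= /imsetP[a' _ ->]];
      rewrite !ffunE (negbTE jS).
  apply/eqP; apply: contraT => bb'; have /prodf_neq0/(_ (val b' j)) := h j jS.
  by rewrite fgr // eqxx eq_sym bb' => /(_ isT).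
by apply/prodf_neq0 => c cb; rewrite fgr.
Qed.

(** A bad grid point is determined by its restrictions to [S] and to its complement. *)
Let card_bad S : (#|[set a | `[< bad S a >]]%SET|
  <= (#|J| * (L.+1 * (2 * D))).+1 ^ k * L.+1 ^ (#|J| - #|S|))%N.
Proof.
pose C := [set a in pffun_on (ord0 : 'I_L.+1) (mem (~: S)) predT]%SET.
have <- : #|C| = (L.+1 ^ (#|J| - #|S|))%N.
  by rewrite cardsE card_pffun_on card_ord -(cardsC S) addKn.
apply: leq_trans (leq_mul (card_bad_restr S) (leqnn _)); rewrite -cardsX.
rewrite -(@card_in_imset _ _ (fun a => (restr S a, restr (~: S) a))) => [|a a' _ _].
  apply/subset_leq_card/fintype.subsetP => _ /imsetP[a aS ->].
  rewrite !inE /=; apply/andP; split.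
    by apply/imsetP; exists a => //; move: aS; rewrite inE.
  apply/pffun_onP; split => //; apply/fintype.subsetP => j; rewrite !inE ffunE inE.
  by case: ifP => //; rewrite eqxx.
case=> /ffunP e1 /ffunP e2; apply/ffunP => j.
move: (e1 j) (e2 j); rewrite !ffunE inE; by case: (j \in S).
Qed.

(** With [k.+1] coordinates in [S], the number of bad points is of order
    [L ^ k * L ^ (#|J| - k.+1)], which is a factor [L] short of the whole grid; the
    hypothesis on [L] absorbs the constants and the number of sets [S]. *)
Lemma good_grid_point : (2 ^ #|J| * (#|J| * (2 * D)).+1 ^ k < L.+1)%N ->
  exists a : {ffun J -> 'I_L.+1}, forall x,
    (#|[set j | (`|f j x| == gr (a j))%R]%SET| <= k)%N.
Proof.
move=> hL; apply: contrapT => /forallNP h.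
pose Sk := [set S : {set J} | #|S| == k.+1]%SET.
have {h} h (a : {ffun J -> 'I_L.+1}) :
    exists2 S, S \in Sk & a \in [set a | `[< bad S a >]]%SET.
  have /existsNP[x /negP] := h a; rewrite -ltnNge => hx.
  have /card_geqP[s [us ss sZ]] := hx.
  exists [set j in s]%SET; rewrite inE; first by rewrite cardsE (card_uniqP us) ss.
  apply/asboolP; exists x => j; rewrite inE => /sZ.
  by rewrite inE => /eqP.
have cov : (#|{ffun J -> 'I_L.+1}| <= \sum_(S in Sk) #|[set a | `[< bad S a >]]%SET|)%N.
  under eq_bigr do rewrite -sum1_card big_mkcond /=.
  rewrite exchange_big /= -sum1_card leq_sum // => a _.
  by have [S Sk' aS] := h a; rewrite (bigD1 S) //= aS.
have : (#|{ffun J -> 'I_L.+1}| < L.+1 ^ #|J|)%N; last by rewrite card_ffun card_ord ltnn.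
apply: leq_ltn_trans cov _; have [kJ|Jk] := ltnP k #|J|; last first.
  rewrite big_pred0 ?expn_gt0 // => S; rewrite inE; apply/negP => /eqP cS.
  by have := max_card (mem S); rewrite cS ltnNge Jk.
pose c := (#|J| * (2 * D)).+1.
have bound S : S \in Sk -> (#|[set a | `[< bad S a >]]%SET| <= c ^ k * L.+1 ^ (#|J|.-1))%N.
  rewrite inE => /eqP cS; apply: leq_trans (card_bad S) _; rewrite cS.
  have -> : (#|J|.-1 = k + (#|J| - k.+1))%N by clear -kJ; lia.
  rewrite expnD [leqRHS]mulnA leq_mul // -expnMn.
  have [->//|k0] := posnP k; rewrite leq_exp2r // /c.
  by move: (#|J|) => M; clear; nia.
apply: (@leq_ltn_trans (\sum_(S in Sk) c ^ k * L.+1 ^ #|J|.-1)%N).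
  exact: leq_sum.
rewrite sum_nat_const.
have cSk : (#|Sk| <= 2 ^ #|J|)%N.
  rewrite -cardsT -card_powerset subset_leq_card //.
  by apply/fintype.subsetP => S _; rewrite inE finset.subsetT.
rewrite mulnA; apply: leq_ltn_trans (leq_mul (leq_mul cSk (leqnn _)) (leqnn _)) _.
rewrite -[X in (_ < _ ^ X)%N](prednK (leq_ltn_trans _ kJ)) // expnS.
by rewrite ltn_pmul2r ?expn_gt0.
Qed.

End Grid.

(** The grid consists of multiples of [tau / L.+2]. *)
Lemma generic_thresholds (tau : R) : 0 < tau -> exists t : J -> R,
  (forall j, 0 < t j < tau) /\
  forall x, (#|[set j | (`|f j x| == t j)%R]%SET| <= k)%N.
Proof.
move=> tau0; pose L := (2 ^ #|J| * (#|J| * (2 * D)).+1 ^ k)%N.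
pose gr (a : 'I_L.+1) : R := tau * a.+1%:R / L.+2%:R.
have gr_gt0 a : 0 < gr a by rewrite divr_gt0 ?mulr_gt0 ?ltr0n.
have gr_inj : injective gr.
  move=> a b /mulIf; rewrite invr_eq0 pnatr_eq0 => /(_ isT).
  by move=> /(mulfI (lt0r_neq0 tau0)) /eqP; rewrite eqr_nat eqSS => /eqP /val_inj.
have [|a aP] := good_grid_point gr gr_inj gr_gt0; first by rewrite ltnS.
exists (fun j => gr (a j)); split=> // j; rewrite gr_gt0 /=.
by rewrite /gr ltr_pdivrMr ?ltr0n // ltr_pM2l // ltr_nat ltnS ltn_ord.
Qed.

End GenericThresholds.

(** * Minimizing over a sign cell *)

Lemma finite_positive_bound {R : realType} (I : finType) (P : pred I) (F : I -> R) :
  (forall i, P i -> 0 < F i) -> exists2 e, 0 < e & forall i, P i -> e <= F i.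
Proof.
move=> F0; exists (\big[Num.min/1]_(i | P i) F i); first exact: lt_bigmin.
by move=> i Pi; exact: bigmin_le_cond.
Qed.

Lemma box_minimum {R : realType} {k : nat} (f : 'rV[R]_k -> R) (rho : R) :
  0 <= rho -> continuous f -> exists2 x : 'rV[R]_k, (forall i, `|x 0 i| <= rho) &
    forall y : 'rV[R]_k, (forall i, `|y 0 i| <= rho) -> f x <= f y.
Proof.
move=> rho0 cf; pose K := [set x : 'rV[R]_k | forall i, `[- rho, rho]%classic (x 0 i)].
have KE x : K x <-> forall i, `|x 0 i| <= rho.
  by split => h i; have := h i; rewrite /= in_itv /= ler_norml.
have [|||x] := @EVT_min_rV R k f K.
- by exists 0; apply/KE => i; rewrite mxE normr0.
- by apply: (@rV_compact _ _ (fun=> `[- rho, rho]%classic)) => i; exact: segment_compact.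
- exact: continuous_subspaceT.
rewrite inE => /KE Kx xmin; exists x => // y Ky; apply: xmin.
by rewrite inE; apply/KE.
Qed.

(** Fermat's condition.  Writing [q = q(0) + s * r(s)], a nonzero [r(0) = q`_1] would
    make [s * r(s)] negative for small [s] of sign opposite to [r(0)]. *)
Lemma poly_local_min {R : realType} (q : {poly R}) :
  (\forall s \near 0, q.[0] <= q.[s]) -> q`_1 = 0.
Proof.
move=> qmin; pose r := drop_poly 1 q.
have qE s : q.[s] = q.[0] + r.[s] * s.
  rewrite -{1}[q](poly_take_drop 1) hornerD hornerM hornerXn expr1; congr (_ + _).
  rewrite horner_coef0 (size1_polyC (size_take_poly 1 q)) hornerC.
  by rewrite coef_take_poly.
have -> : q`_1 = r.[0] by rewrite horner_coef0 coef_drop_poly.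
apply/eqP; apply: contraT => r0.
have r0' : 0 < `|r.[0]| by rewrite normr_gt0.
have /cvgrPdist_lt /(_ _ r0') rnear := @continuous_horner R r 0.
have [e /= e0 eP] : \forall s \near 0, q.[0] <= q.[s] /\ `|r.[0] - r.[s]| < `|r.[0]|.
  by near=> s; split; near: s.
pose s := - Num.sg r.[0] * (e / 2).
have sE : `|s| = e / 2.
  by rewrite normrM normrN normr_sg r0 mul1r gtr0_norm // divr_gt0.
have := eP s; rewrite /ball_ /= sub0r normrN sE.
have : e / 2 < e by lra.
move=> -> /(_ isT) []; rewrite (qE s) lerDl => rs.
have e2 : 0 < e / 2 by lra.
move: rs; rewrite {2}/s mulrCA.
case: (ltgtP r.[0] 0) r0 => // r00 _.
  rewrite (ltr0_sg r00) (ltr0_norm r00) => rs.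
  rewrite ltr_norml => /andP[+ _]; nra.
rewrite (gtr0_sg r00) (gtr0_norm r00) => rs.
rewrite ltr_norml => /andP[_]; nra.
Unshelve. all: by end_near.
Qed.

Lemma sum_continuous {R : realType} (T : topologicalType) (I : Type) (r : seq I)
    (P : pred I) (F : I -> T -> R) : (forall i, continuous (F i)) ->
  continuous (fun x => \sum_(i <- r | P i) F i x).
Proof. by move=> cF; apply: continuous_big => //; exact: add_continuous. Qed.

Lemma continuous_norm_sub {R : realType} (T : topologicalType) (g : T -> R) (c : R) :
  continuous g -> continuous (fun x => `|g x - c|).
Proof.
move=> cg x; apply: cvg_norm.
by apply: cvgB; [exact: cg|exact: cst_continuous].
Qed.

Section SignPatterns.
Context {R : realType} {k : nat} {J : finType} (D : nat) (f : J -> 'rV[R]_k -> R).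
Hypothesis pf : forall j, polfun D (f j).
Implicit Types (sigma : {ffun J -> bool}) (x v : 'rV[R]_k) (B : {set J * bool}).

Definition signed (b : bool) (y : R) : R := if b then y else - y.

Lemma polfun_signed b j : polfun D (fun x => signed b (f j x)).
Proof.
case: b => //=; under eq_fun do rewrite -mulN1r.
exact: polfun_scale.
Qed.

Lemma signed_norm b y : 0 < signed b y -> `|y| = signed b y.
Proof.
case: b => /= y0; first exact: gtr0_norm.
by rewrite ltr0_norm // -oppr_gt0.
Qed.

(** By compactness the exact statement that at most [k] equalities [`|f j x| = t j] hold
    at once passes to approximate equalities, uniformly on a box: for each set [S] of
    [k.+1] indices the sum of the deviations over [S] has a positive minimum. *)
Lemma uniform_gap (t : J -> R) (rho : R) : 0 <= rho -> (forall j, 0 < t j) ->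
  (forall x, (#|[set j | (`|f j x| == t j)%R]%SET| <= k)%N) ->
  exists eta, [/\ 0 < eta, forall j, eta < t j &
    forall x, (forall i, `|x 0 i| <= rho) ->
      (#|[set j | (`| `|f j x| - t j| <= eta)%R]%SET| <= k)%N].
Proof.
move=> rho0 t0 tgen; pose F (S : {set J}) x : R := \sum_(j in S) `| `|f j x| - t j|.
have /choice[e eP] : forall S : {set J}, exists e : R, 0 < e /\
    (#|S| = k.+1 -> forall x, (forall i, `|x 0 i| <= rho) -> e <= F S x).
  move=> S; have [cS|cS] := eqVneq #|S| k.+1; last first.
    by exists 1; split => // /eqP; rewrite (negbTE cS).
  have [|x _ xmin] := box_minimum (F S) rho rho0.
    apply: sum_continuous => j; apply: continuous_norm_sub => y.
    exact: (cvg_norm (polfun_continuous _ _ (pf j) y)).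
  exists (F S x); split => [|_]; last exact: xmin.
  rewrite lt_neqAle sumr_ge0 // andbT eq_sym psumr_eq0 //.
  apply/negP => /allP Fx0; have := tgen x; rewrite leqNgt => /negP; apply.
  rewrite -cS; apply/subset_leq_card/fintype.subsetP => j jS.
  by have := Fx0 j (mem_index_enum _); rewrite jS normr_eq0 subr_eq0 inE.
have [e0 e0_gt0 e0P] :=
  finite_positive_bound _ xpredT e (fun S _ => (eP S).1).
have [t1 t1_gt0 t1P] := finite_positive_bound _ xpredT t (fun j _ => t0 j).
(* The divisor exceeds the [k.+1] summands of [F S], and exceeds 1 even for [k = 0]. *)
pose eta : R := Num.min e0 t1 / k.+2%:R.
have m0 : 0 < Num.min e0 t1 by rewrite lt_min e0_gt0.
have k2 : (1 : R) < k.+2%:R by rewrite ltr1n.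
have eta0 : 0 < eta by rewrite divr_gt0 ?ltr0n.
exists eta; split => // [j|x xrho].
  apply: lt_le_trans (t1P j isT); rewrite ltr_pdivrMr ?ltr0n //.
  apply: (@le_lt_trans _ _ t1); first by rewrite ge_min lexx orbT.
  by rewrite ltr_pMr.
rewrite leqNgt; apply/negP => /card_geqP[s [us ss sZ]].
pose S := [set j in s]%SET; have cS : #|S| = k.+1 by rewrite cardsE (card_uniqP us).
have := (eP S).2 cS x xrho; apply/negP; rewrite -ltNge.
apply: (@le_lt_trans _ _ (\sum_(j in S) eta)).
  by apply: ler_sum => j; rewrite inE => /sZ; rewrite inE.
rewrite sumr_const cS -mulr_natr -mulrA; apply: lt_le_trans (e0P S isT).
apply: (@lt_le_trans _ _ (Num.min e0 t1)); last by rewrite ge_min lexx.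
by rewrite gtr_pMr // mulrC ltr_pdivrMr ?ltr0n // mul1r ltr_nat.
Qed.

Section Penalty.
Variables (t : J -> R) (C : R).

(** The exponent exceeds the degree [2 * D] of the penalty, so that in the critical
    point equations the pure powers dominate. *)
Definition coercive x : R := \sum_i x 0 i ^+ (2 * D.+1).

Definition penalty B x : R :=
  C * \sum_(jb in B) (t jb.1 - signed jb.2 (f jb.1 x)) ^+ 2.

(** The constraints [t j <= signed (sigma j) (f j x)] that are violated or tight at
    [x], each recorded with its sign. *)
Definition active sigma x : {set J * bool} :=
  [set jb | (jb.2 == sigma jb.1) && (signed jb.2 (f jb.1 x) <= t jb.1)]%SET.

Lemma coercive_term i x : x 0 i ^+ (2 * D.+1) <= coercive x.
Proof.
rewrite /coercive (bigD1 i) //= lerDl sumr_ge0 // => j _.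
by rewrite exprM exprn_ge0 // sqr_ge0.
Qed.

Lemma coercive_ge0 x : 0 <= coercive x.
Proof. by apply: sumr_ge0 => i _; rewrite exprM exprn_ge0 // sqr_ge0. Qed.

Lemma coercive_bound x H : 1 <= H -> coercive x <= H -> forall i, `|x 0 i| <= H.
Proof.
move=> H1 xH i; have [x1|/ltW x1] := leP `|x 0 i| 1; first exact: le_trans H1.
apply: le_trans xH; apply: le_trans (coercive_term i x).
rewrite -[X in _ <= X]ger0_norm; last by rewrite exprM exprn_ge0 // sqr_ge0.
by rewrite normrX ler_eXnr // muln_gt0.
Qed.

Lemma polfun_coercive : polfun (2 * D.+1) coercive.
Proof.
apply: polfun_sum => i.
by have := polfun_exp 1 (2 * D.+1) _ (polfun_coord R k i); rewrite muln1.
Qed.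

Lemma polfun_penalty B : polfun (2 * D) (penalty B).
Proof.
apply: polfun_scale; apply: polfun_sum => jb; apply: polfun_exp.
apply: (polfun_sub _ (fun=> t jb.1)); last exact: polfun_signed.
exact: polfun_widen (leq0n _) (polfun_cst _ _ _).
Qed.

Lemma coercive_line i x : exists2 q : {poly R},
  forall s, coercive (x + s *: delta_mx 0 i) = q.[s] &
  q`_1 = (2 * D.+1)%:R * x 0 i ^+ (2 * D).+1.
Proof.
exists (('X + (x 0 i)%:P) ^+ (2 * D.+1) +
        (\sum_(j | j != i) x 0 j ^+ (2 * D.+1))%:P).
  move=> s; rewrite /coercive (bigD1 i) //= !hornerE !mxE !eqxx /= mulr1.
  rewrite [s + _]addrC; congr (_ + _); apply: eq_bigr => j /negbTE ji.
  by rewrite !mxE ji andbF mulr0 addr0.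
set p := _ + _; have -> : p`_1 = p^`().[0].
  by rewrite horner_coef0 coef_deriv mulr1n.
rewrite /p derivD derivC addr0 deriv_exp derivD derivX derivC addr0 mul1r.
by rewrite hornerMn horner_exp !hornerE mulr_natl; congr (_ ^+ _ *+ _); lia.
Qed.

(** The [i]-th partial derivative of [coercive + penalty B] vanishes at a local minimum;
    the coercive part contributes a multiple of [x_i ^ (2 * D).+1]. *)
Lemma critical_equation B i : exists2 g, polfun (2 * D) g & forall x,
  (\forall s \near (0 : R), coercive x + penalty B x <=
     coercive (x + s *: delta_mx 0 i) + penalty B (x + s *: delta_mx 0 i)) ->
  x 0 i ^+ (2 * D).+1 = g x.
Proof.
have [g pg gP] := polfun_line _ _ i (polfun_penalty B).
pose c : R := (2 * D.+1)%:R; have c0 : c != 0 by rewrite pnatr_eq0.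
exists (fun x => - c^-1 * g x) => [|x xmin]; first exact: polfun_scale.
have [q qP q1] := gP x; have [r rP r1] := coercive_line i x.
have : (r + q)`_1 = 0.
  apply: poly_local_min; apply: filterS xmin => s.
  by rewrite !hornerD -!qP -!rP scale0r addr0.
rewrite coefD q1 r1 -/c => /eqP; rewrite addr_eq0 => /eqP cx.
by apply: (mulfI c0); rewrite cx mulNr mulrN mulrA mulfV // mul1r.
Qed.

(** The positive part of [z], in a form whose continuity is immediate. *)
Definition hinge (z : R) : R := (z + `|z|) / 2.

Lemma hinge_pos z : 0 <= z -> hinge z = z.
Proof. by move=> z0; rewrite /hinge ger0_norm //; lra. Qed.

Lemma hinge_neg z : z <= 0 -> hinge z = 0.
Proof. by move=> z0; rewrite /hinge ler0_norm //; lra. Qed.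

Definition hinged sigma x : R :=
  coercive x + C * \sum_j hinge (t j - signed (sigma j) (f j x)) ^+ 2.

Lemma hinged_continuous sigma : continuous (hinged sigma).
Proof.
move=> x; apply: continuousD; first exact: (polfun_continuous _ _ polfun_coercive x).
apply: continuousM; first exact: cst_continuous.
move: x; apply: sum_continuous => j x.
have cz : {for x, continuous (fun x => t j - signed (sigma j) (f j x))}.
  apply: continuousB; first exact: cst_continuous.
  exact: (polfun_continuous _ _ (polfun_signed _ _) x).
have ch : {for x, continuous (fun x => hinge (t j - signed (sigma j) (f j x)))}.
  apply: continuousM; last exact: cst_continuous.
  by apply: continuousD => //; exact: (cvg_norm cz).
exact: (continuousM ch ch).
Qed.

Lemma penalty_active sigma x y : penalty (active sigma x) y =
  C * \sum_(j | signed (sigma j) (f j x) <= t j)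
        (t j - signed (sigma j) (f j y)) ^+ 2.
Proof.
congr (_ * _).
rewrite (reindex_onto (fun j => (j, sigma j)) fst) /= => [|[j b]]; last first.
  by rewrite inE /= => /andP[/eqP ->].
by apply: eq_bigl => j; rewrite inE /= !eqxx /= andbT.
Qed.

(** The point [x] minimizes [hinged sigma] on a box.  Comparing with the feasible point
    [v] gives [hinged sigma x <= H]; this keeps [x] inside the box and, as [C] is
    large, bounds every violation by [eta].  Inactive constraints stay inactive near
    [x], so there [hinged sigma] is at most [coercive + penalty (active sigma x)], with
    equality at [x]: hence [x] is also a local minimum of the latter, which is a
    polynomial. *)
Lemma cell_critical_point sigma v (H eta : R) :
  1 <= H -> coercive v <= H -> 0 < eta -> H < C * eta ^+ 2 ->
  (forall j, t j <= signed (sigma j) (f j v)) ->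
  exists x, [/\ forall i, `|x 0 i| <= H,
    forall j, t j - eta <= signed (sigma j) (f j x) &
    forall i, \forall s \near (0 : R),
      coercive x + penalty (active sigma x) x <=
      coercive (x + s *: delta_mx 0 i) +
        penalty (active sigma x) (x + s *: delta_mx 0 i)].
Proof.
move=> H1 vH eta0 HC tv.
have C0 : 0 < C by have := exprn_gt0 2 eta0; nra.
have H0 : 0 <= H + 1 by lra.
have [x xK xmin] := box_minimum _ _ H0 (hinged_continuous sigma).
have hx y : 0 <= C * \sum_j hinge (t j - signed (sigma j) (f j y)) ^+ 2.
  by rewrite mulr_ge0 ?(ltW C0) // sumr_ge0 // => j _; rewrite sqr_ge0.
have xH : hinged sigma x <= H.
  apply: le_trans (xmin v _) _ => [i|].
    by apply: le_trans (coercive_bound v H H1 vH i) _; lra.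
  rewrite /hinged big1 ?mulr0 ?addr0 // => j _.
  by rewrite hinge_neg ?expr0n // subr_le0.
have xb : forall i, `|x 0 i| <= H.
  by apply: coercive_bound => //; apply: le_trans xH; rewrite lerDl.
exists x; split=> // [j|i].
  rewrite lerBlDr addrC -lerBlDr leNgt; apply/negP => jeta.
  have : C * hinge (t j - signed (sigma j) (f j x)) ^+ 2 <= H.
    apply: le_trans xH; rewrite /hinged (bigD1 j) //= mulrDr addrCA lerDl.
    rewrite addr_ge0 ?coercive_ge0 // mulr_ge0 ?(ltW C0) // sumr_ge0 // => l _.
    exact: sqr_ge0.
  rewrite hinge_pos; last by lra.
  apply/negP; rewrite -ltNge; apply: lt_trans HC _.
  by rewrite ltr_pM2l // ltr_sqr ?nnegrE; lra.
have stay : \forall s \near (0 : R), forall j,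
    t j < signed (sigma j) (f j x) ->
    t j < signed (sigma j) (f j (x + s *: delta_mx 0 i)).
  apply: (@filter_forall R J _ (nbhs (0 : R)) _) => j.
  have [g _ gP] := polfun_line _ _ i (polfun_signed (sigma j) j).
  have [q qP _] := gP x.
  have [tj|_] := ltP (t j) (signed (sigma j) (f j x)); last by near=> s.
  have q0 : t j < q.[0] by rewrite -qP scale0r addr0.
  have := @continuous_horner R q 0.
  move=> /cvgr_gt /(_ _ q0); apply: filterS => s.
  by rewrite -qP.
have small : \forall s \near (0 : R), `|s| < 1.
  by apply/nbhs_ballP; exists 1 => //= s; rewrite /ball /= sub0r normrN.
near=> s; have s1 : `|s| < 1 by near: s.
have sstay : forall j, t j < signed (sigma j) (f j x) ->
    t j < signed (sigma j) (f j (x + s *: delta_mx 0 i)) by near: s.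
set y := x + s *: delta_mx 0 i.
have -> : coercive x + penalty (active sigma x) x = hinged sigma x.
  rewrite penalty_active /hinged big_mkcond /=; congr (_ + _ * _).
  apply: eq_bigr => j _; case: leP => xj; first by rewrite hinge_pos ?subr_ge0.
  by rewrite hinge_neg ?expr0n // subr_le0 ltW.
apply: le_trans (xmin y _) _ => [l|].
  rewrite !mxE eqxx /=; apply: le_trans (ler_normD _ _) _; apply: lerD => //.
  by rewrite normrM; case: (l == i); rewrite ?normr1 ?normr0; lra.
rewrite penalty_active /hinged [in leRHS]big_mkcond /= lerD2l ler_pM2l //.
apply: ler_sum => j _.
case: (leP (signed (sigma j) (f j x)) (t j)) => xj; last first.
  by rewrite hinge_neg ?expr0n // subr_le0 ltW // sstay.
case: (lerP 0 (t j - signed (sigma j) (f j y))) => yj; first by rewrite hinge_pos.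
by rewrite hinge_neg ?(ltW yj) // expr0n /= sqr_ge0.
Unshelve. all: by end_near.
Qed.

End Penalty.
End SignPatterns.

(** * The number of sign patterns *)

Section SignPatternCount.
Context {R : realType} {k : nat} {J : finType} (D : nat).
Implicit Types (f : J -> 'rV[R]_k -> R) (A : {set {ffun J -> bool}}).

(** Each [sigma] in [A] is mapped to its minimizer [x sigma] and the set [act sigma] of
    active signed constraints there.  The minimizer determines [sigma]; there are few
    sets of active constraints since they have at most [k] elements, and for each of
    them at most [(2 * D).+1 ^ k] critical points. *)
Lemma card_strict_sign_patterns f A : (forall j, polfun D (f j)) ->
  (forall sigma, sigma \in A -> exists x, forall j, 0 < signed (sigma j) (f j x)) ->
  (#|A| <= #|[set B : {set J * bool} | (#|B| <= k)%N]%SET| * (2 * D).+1 ^ k)%N.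
Proof.
move=> pf realized.
have /choice[v vP] : forall sigma, exists x, sigma \in A ->
    forall j, 0 < signed (sigma j) (f j x).
  move=> sigma; have [/realized[x xP]|_] := boolP (sigma \in A); first by exists x.
  by exists 0.
have [tau tau0 tauP] := finite_positive_bound _ (fun p => p.1 \in A)
  (fun p : {ffun J -> bool} * J => signed (p.1 p.2) (f p.2 (v p.1)))
  (fun p pA => vP _ pA p.2).
have [t [tP tgen]] := generic_thresholds D f pf tau tau0.
pose H : R := 1 + \sum_(sigma in A) coercive D (v sigma).
have H1 : 1 <= H by rewrite lerDl sumr_ge0 // => sigma _; exact: coercive_ge0.
have vH sigma : sigma \in A -> coercive D (v sigma) <= H.
  move=> sA; rewrite /H (bigD1 sigma) //= addrCA lerDl addr_ge0 //.
  by apply: sumr_ge0 => tau' _; exact: coercive_ge0.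
have [eta [eta0 etat gap]] := uniform_gap D f pf t H (le_trans ler01 H1)
  (fun j => proj1 (andP (tP j))) tgen.
pose C := H / eta ^+ 2 + 1.
have HC : H < C * eta ^+ 2.
  by rewrite mulrDl mul1r divfK ?ltrDl ?exprn_gt0 // expf_neq0 // gt_eqF.
have /choice[x xP] : forall sigma, exists x : 'rV[R]_k, sigma \in A ->
  [/\ forall i, `|x 0 i| <= H,
    forall j, t j - eta <= signed (sigma j) (f j x) &
    forall i, \forall s \near (0 : R),
      coercive D x + penalty f t C (active f t sigma x) x <=
      coercive D (x + s *: delta_mx 0 i) +
        penalty f t C (active f t sigma x) (x + s *: delta_mx 0 i)].
  move=> sigma; have [sA|_] := boolP (sigma \in A); last by exists 0.
  have [|x xP] := cell_critical_point D f pf t C sigma (v sigma) H eta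
    H1 (vH _ sA) eta0 HC.
    move=> j; have /andP[_ /ltW tj] := tP j; apply: le_trans tj _.
    exact: (tauP (sigma, j) sA).
  by exists x.
pose act sigma := active f t sigma (x sigma).
have x_sign sigma j : sigma \in A -> 0 < signed (sigma j) (f j (x sigma)).
  by move=> /xP[_ xt _]; apply: lt_le_trans (xt j); rewrite subr_gt0.
have x_inj : {in A &, injective x}.
  move=> sigma sigma' sA sA' e; apply/ffunP => j.
  have := x_sign _ j sA'; rewrite -e; have := x_sign _ j sA.
  case: (sigma j); case: (sigma' j) => //=;
    by rewrite oppr_gt0 => h /(lt_trans h); rewrite ltxx.
have act_card sigma : sigma \in A -> (#|act sigma| <= k)%N.
  move=> sA; have [xH xt _] := xP _ sA; apply: leq_trans (gap _ xH).
  apply: leq_trans (leq_imset_card (fun j => (j, sigma j)) _).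
  apply/subset_leq_card/fintype.subsetP => -[j b]; rewrite inE /= => /andP[/eqP -> xtj].
  apply/imsetP; exists j => //; rewrite inE (signed_norm _ _ (x_sign _ j sA)).
  by rewrite ler_norml; have := xt j; lra.
have fiber B : (#|[set sigma in A | act sigma == B]%SET| <= (2 * D).+1 ^ k)%N.
  set X := [set _ in _ | _]%SET; rewrite -[#|X|]card_sig.
  have /choice[g gP] : forall i, exists g, polfun (2 * D) g /\ forall y : 'rV[R]_k,
      (\forall s \near (0 : R), coercive D y + penalty f t C B y <=
        coercive D (y + s *: delta_mx 0 i) + penalty f t C B (y + s *: delta_mx 0 i)) ->
      y 0 i ^+ (2 * D).+1 = g y.
    by move=> i; have [g pg gP] := critical_equation D f pf t C B i; exists g.
  apply: (card_critical_le (fun sigma : {sigma | sigma \in X} => x (val sigma)) _ g).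
  - move=> [sigma sX] [sigma' sX'] /= e; apply/val_inj => /=.
    by apply: x_inj e; [move: sX | move: sX']; rewrite inE => /andP[].
  - by move=> i; exact: (gP i).1.
  - move=> [sigma /= sX] i; apply: (gP i).2; move: sX; rewrite inE => /andP[sA /eqP <-].
    by have [_ _] := xP _ sA; apply.
set small := [set B : {set J * bool} | _]%SET.
rewrite -sum1_card (partition_big act (mem small)) /=.
  rewrite -sum_nat_const; apply: leq_sum => B _.
  apply: leq_trans (fiber B); rewrite -sum1_card; apply/eq_leq/eq_bigl => sigma.
  by rewrite inE.
by move=> sigma /act_card; rewrite inE.
Qed.

(** A pattern recording [0 <= f j x] becomes strict after adding to all [f j] a constant
    smaller in absolute value than all negative values taken at the finitely many
    chosen points. *)
Lemma card_sign_patterns f A : (forall j, polfun D (f j)) ->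
  (forall sigma, sigma \in A -> exists x, forall j, sigma j = (0 <= f j x)) ->
  (#|A| <= #|[set B : {set J * bool} | (#|B| <= k)%N]%SET| * (2 * D).+1 ^ k)%N.
Proof.
move=> pf realized.
have /choice[v vP] : forall sigma, exists x, sigma \in A ->
    forall j, sigma j = (0 <= f j x).
  move=> sigma; have [/realized[x xP]|_] := boolP (sigma \in A); first by exists x.
  by exists 0.
have [th th0 thP] := finite_positive_bound _
  (fun p : {ffun J -> bool} * J => f p.2 (v p.1) < 0) (fun p => - f p.2 (v p.1))
  (fun p => ltac:(rewrite oppr_gt0; exact: id)).
apply: (card_strict_sign_patterns (fun j x => f j x + th / 2)) => [j|sigma sA].
  exact: polfun_addc.
exists (v sigma) => j; rewrite vP //; case: (leP 0 (f j (v sigma))) => fj /=; first by lra.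
by have /= := thP (sigma, j) fj; lra.
Qed.

End SignPatternCount.

(** * Sign patterns near tensors of low rank *)

(** Each subset counted has weight [y ^+ #|B| >= y ^+ K], and the weights of all subsets
    add up to [(1 + y) ^+ #|I|]. *)
Lemma card_small_subsets {R : realType} (I : finType) (K : nat) (y : R) :
  0 < y -> y <= 1 ->
  #|[set B : {set I} | (#|B| <= K)%N]%SET|%:R * y ^+ K <= (1 + y) ^+ #|I|.
Proof.
move=> y0 y1.
have -> : (1 + y) ^+ #|I| = \sum_(B : {set I}) y ^+ #|B|.
  rewrite addrC -prodr_const (eq_bigl xpredT) // bigA_distr.
  apply: eq_bigr => B _; rewrite -prodr_const [RHS]big_mkcond /=.
  by apply: eq_bigr.
rewrite mulr_natl -sumr_const [leRHS](bigID (fun B : {set I} => #|B| <= K)%N) /=.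
apply: ler_wpDr; first by apply: sumr_ge0 => B _; rewrite exprn_ge0 // ltW.
rewrite (eq_bigl (fun B : {set I} => #|B| <= K)%N) => [|B]; last by rewrite inE.
by apply: ler_sum => B BK; rewrite ler_wiXn2l // ltW.
Qed.

Section LowRankPatterns.
Context {R : realType} {d : nat} (n : 'I_d -> nat) (r : nat).
Hypothesis d_gt0 : (0 < d)%N.

(** Index of a parameter of a sum of [r] products of vectors: a direction [j], a summand
    and a coordinate of its [j]-th vector. *)
Definition factor_entry : finType := {j : 'I_d & ('I_r * 'I_(n j))%type}.

Lemma card_factor_entry : #|factor_entry| = (r * \sum_j n j)%N.
Proof.
rewrite card_tagged sumnE big_map big_enum /= big_distrr /=.
by apply: eq_bigr => j _; rewrite card_prod !card_ord.
Qed.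

Definition low_rank_entry (i : tindex n) (x : 'rV[R]_#|factor_entry|) : R :=
  \sum_(s < r) \prod_(j < d)
    x 0 (enum_rank (Tagged (fun j => ('I_r * 'I_(n j))%type) (s, i j))).

Lemma polfun_low_rank_entry i : polfun d (low_rank_entry i).
Proof.
apply: polfun_sum => s; rewrite -[X in polfun X]muln1 -{1}[d]card_ord.
by apply: polfun_prod => j; exact: polfun_coord.
Qed.

(** A decomposition with fewer than [r] summands is padded with zero vectors; as
    [0 < d], their products vanish. *)
Lemma low_rank_entryP (T : tensor R n) : (tensor_rank T <= r)%N ->
  exists x, forall i, T i = low_rank_entry i x.
Proof.
have [[F [F1 TE]] _] := tensor_rankP T d_gt0 => Tr.
have /choice[u uP] : forall s, exists u : forall j : 'I_d, 'I_(n j) -> R,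
    forall i, F s i = \prod_(j < d) u j (i j).
  by move=> s; have [] := F1 s.
pose pad (s : nat) (j : 'I_d) (a : 'I_(n j)) : R :=
  if insub s is Some s' then u s' j a else 0.
pose entry (e : factor_entry) : R := pad (tagged e).1 (tag e) (tagged e).2.
exists (\row_l entry (enum_val l)) => i.
rewrite {1}TE sum_ffunE.
rewrite (eq_bigr (fun s : 'I__ => \prod_j pad s j (i j))) => [|s _]; last first.
  by rewrite uP; apply: eq_bigr => j _; rewrite /pad valK.
rewrite (big_ord_widen r (fun s => \prod_j pad s j (i j))) // big_mkcond /=.
apply: eq_bigr => s _; case: ifPn => [_|sT].
  by apply: eq_bigr => j _; rewrite mxE enum_rankK.
rewrite (bigD1 (Ordinal d_gt0)) //= mxE enum_rankK /entry /= /pad insubN //.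
by rewrite mul0r.
Qed.

End LowRankPatterns.

Section SignTensors.
Context {R : realType} {d : nat} (n : 'I_d -> nat).

Definition sign_tensor (sigma : {ffun tindex n -> bool}) : tensor R n :=
  [ffun i => if sigma i then 1 else -1].

Lemma sign_tensor_inj : injective sign_tensor.
Proof.
move=> s s' /ffunP e; apply/ffunP => i; have := e i; rewrite !ffunE.
by case: (s i); case: (s' i) => // /eqP; rewrite -subr_eq0 => /eqP; lra.
Qed.

Definition mismatch (s s' : {ffun tindex n -> bool}) : {set tindex n} :=
  [set i | s i != s' i]%SET.

Lemma card_hamming_ball (s : {ffun tindex n -> bool}) K :
  (#|[set s' | (#|mismatch s' s| <= K)%N]%SET|
    <= #|[set B : {set tindex n} | (#|B| <= K)%N]%SET|)%N.
Proof.
rewrite -(@card_in_imset _ _ (mismatch^~ s)) => [|s1 s2 _ _ /setP e].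
  by apply/subset_leq_card/fintype.subsetP => _ /imsetP[s' + ->]; rewrite !inE.
apply/ffunP => i; have := e i; rewrite !inE.
by case: (s i); case: (s1 i); case: (s2 i).
Qed.

(** Where the signs disagree, [T i] and [T i - T' i] have the same sign and
    [`|T i| <= `|T i - T' i|]. *)
Lemma mismatch_le_l1norm (T T' : tensor R n) (s : {ffun tindex n -> bool}) m :
  0 <= m -> (forall i, m <= `|T i|) -> tensor_sign T = sign_tensor s ->
  #|mismatch s [ffun i => 0 <= T' i]|%:R * m <= l1norm (T - T').
Proof.
move=> m0 mT /ffunP Ts; rewrite mulr_natl -sumr_const /l1norm.
rewrite [leRHS](bigID (mem (mismatch s [ffun i => 0 <= T' i]))) /=.
apply: ler_wpDr; first by apply: sumr_ge0 => i _.
apply: ler_sum => i; rewrite inE !ffunE => smis; apply: le_trans (mT i) _.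
have := Ts i; rewrite !ffunE; case: (s i) smis => /=.
  case: (ltgtP (T i) 0) => [Ti|Ti|->].
  - by rewrite ltr0_sg // => _ /eqP; rewrite -subr_eq0 => /eqP; lra.
  - rewrite -ltNge => T'i _; rewrite !ger0_norm; lra.
  - by rewrite sgr0 => _ /eqP; rewrite -subr_eq0 => /eqP; lra.
case: (ltgtP (T i) 0) => [Ti|Ti|->].
- rewrite negbK => T'i _; rewrite !ler0_norm; lra.
- by rewrite gtr0_sg // => _ /eqP; rewrite -subr_eq0 => /eqP; lra.
- by rewrite sgr0 => _ /eqP; rewrite -subr_eq0 => /eqP; lra.
Qed.

(** The entry [0] counts as positive. *)
Definition sign_patterns (r : nat) : {set {ffun tindex n -> bool}} :=
  [set p | `[< exists2 T : tensor R n, (tensor_rank T <= r)%N &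
               p = [ffun i => 0 <= T i] >]]%SET.

Definition near_low_rank (r K : nat) : {set {ffun tindex n -> bool}} :=
  [set s | [exists p in sign_patterns r, (#|mismatch s p| <= K)%N]]%SET.

Hypothesis d_gt0 : (0 < d)%N.

Lemma card_sign_patterns_rank r : (#|sign_patterns r| <=
  #|[set B : {set (tindex n * bool)} | (#|B| <= r * \sum_j n j)%N]%SET|
    * (2 * d).+1 ^ (r * \sum_j n j))%N.
Proof.
rewrite -card_factor_entry.
apply: (card_sign_patterns d (low_rank_entry n r)) => [i|p].
  exact: polfun_low_rank_entry.
rewrite inE => /asboolP[T Tr ->]; have [x xP] := low_rank_entryP n r d_gt0 T Tr.
by exists x => i; rewrite ffunE xP.
Qed.

Lemma card_near_low_rank r K : (#|near_low_rank r K| <=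
  #|sign_patterns r| * #|[set B : {set tindex n} | (#|B| <= K)%N]%SET|)%N.
Proof.
rewrite -sum_nat_const.
apply: (@leq_trans (\sum_(p in sign_patterns r)
    #|[set s | (#|mismatch s p| <= K)%N]%SET|)%N); last first.
  by apply: leq_sum => p _; exact: card_hamming_ball.
under eq_bigr do rewrite -sum1_card big_mkcond /=.
rewrite exchange_big /= -sum1_card big_mkcond leq_sum // => s _.
case: ifP => //; rewrite inE => /existsP[p /andP[pr ps]].
by rewrite (bigD1 p) //= inE ps.
Qed.

(** Both counts of small subsets are taken with weight [eps = expR (- L)].  This costs
    [expR ((k + K) * L)], with [k <= d * eps * N] and [K <= eps * N], while the powers
    of [1 + eps] contribute at most [expR (3 * N * eps)] and are absorbed using
    [1 <= L]. *)
Lemma near_low_rank_bound r K (eps L : R) : let N := (\prod_j n j)%N in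
  0 < eps -> eps <= 1 -> 1 <= L -> eps = expR (- L) ->
  (r * \sum_j n j)%:R <= d%:R * eps * N%:R -> K%:R <= eps * N%:R ->
  #|near_low_rank r K|%:R <=
    expR (N%:R * eps * L * (4 + d%:R + d%:R * ln (2 * d).+1%:R)).
Proof.
move=> N eps0 eps1 L1 epsE; set k := (r * _)%N => kN KN.
have cardJ : #|{: tindex n}| = N.
  by rewrite card_dep_ffun foldrE big_map big_enum; apply: eq_bigr => j _; rewrite card_ord.
have b1 := @card_small_subsets R (tindex n * bool)%type k _ eps0 eps1.
have b2 := @card_small_subsets R (tindex n) K _ eps0 eps1.
move: b1 b2; rewrite card_prod card_bool cardJ.
set a1 := #|_|%:R; set a2 := #|_|%:R => b1 b2.
have eps1x m : (1 + eps) ^+ m <= expR (m%:R * eps).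
  rewrite expRM_natl lerXn2r ?nnegrE ?expR_ge0 ?expR_ge1Dx //.
  by rewrite addr_ge0 // ltW.
have q0 : 0 < (2 * d).+1%:R :> R by rewrite ltr0n.
pose q : R := ln (2 * d).+1%:R.
have lnq0 : 0 <= q by rewrite ln_ge0 // ler1n.
have qE : (2 * d).+1%:R ^+ k = expR (k%:R * q) by rewrite expRM_natl lnK.
have expE m : eps ^+ m = expR (- (m%:R * L)) by rewrite epsE -expRM_natl mulrN.
have bad : #|near_low_rank r K|%:R <= a1 * (2 * d).+1%:R ^+ k * a2.
  rewrite /a1 /a2 -natrX -!natrM ler_nat.
  apply: leq_trans (card_near_low_rank r K) _; rewrite leq_mul2r.
  by rewrite card_sign_patterns_rank orbT.
have a1le : a1 <= expR ((N * 2)%:R * eps + k%:R * L).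
  move: (le_trans b1 (eps1x _)); rewrite expE expRN ler_pdivrMr ?expR_gt0 //.
  by rewrite expRD.
have a2le : a2 <= expR (N%:R * eps + K%:R * L).
  move: (le_trans b2 (eps1x _)); rewrite expE expRN ler_pdivrMr ?expR_gt0 //.
  by rewrite expRD.
apply: le_trans bad _; rewrite qE.
apply: (@le_trans _ _ (expR ((N * 2)%:R * eps + k%:R * L) * expR (k%:R * q) *
  expR (N%:R * eps + K%:R * L))).
  by rewrite !ler_pM ?mulr_ge0 ?expR_ge0 ?ler0n.
rewrite -!expRD ler_expR natrM -/q.
have N0 : 0 <= N%:R * eps by rewrite mulr_ge0 // ltW.
have d0 : 0 <= d%:R :> R by [].
have k1 : k%:R * L <= d%:R * (N%:R * eps * L).
  by apply: le_trans (ler_wpM2r _ kN) _; [lra|rewrite [leRHS]mulrC; lra].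
have K1 : K%:R * L <= N%:R * eps * L.
  by rewrite ler_wpM2r //; [lra|rewrite mulrC].
have k2 : k%:R * q <= N%:R * eps * L * (d%:R * q).
  apply: le_trans (ler_wpM2r lnq0 kN) _.
  have -> : d%:R * eps * N%:R * q = N%:R * eps * (d%:R * q) by ring.
  by rewrite ler_wpM2r ?mulr_ge0 // ler_peMr.
have E1 : N%:R * eps <= N%:R * eps * L by rewrite ler_peMr.
lra.
Qed.

End SignTensors.

(** * Approximation by low-rank tensors *)

Theorem mainTheorem7 (R : realType) (d : nat) (d_gt0 : (0 < d)%N) :
  exists eps0 c : R, 0 < eps0 /\ 0 < c /\
  forall eps : R, 0 < eps -> eps < eps0 ->
  forall n : 'I_d -> nat, (forall j, (0 < n j)%N) ->
  let N : nat := (\prod_(j < d) n j)%N in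
  exists S : {fset tensor R n},
    (forall s : tensor R n, s \in S -> signum_tensor s) /\
    (#|` S|)%:R >= 2 ^+ N - 2 `^ (N%:R * c * eps * ln (1 / eps)) /\
    forall T : tensor R n, tensor_sign T \in S ->
      inf [set l1norm (T - T') | T' in
            [set T' : tensor R n | (tensor_rank T')%:R
                                   <= eps * N%:R / (\max_(j < d) n j)%N%:R]]
      >= eps * N%:R * min_abs_entry T.
Proof.
pose w : R := 4 + d%:R + d%:R * ln (2 * d).+1%:R.
have w0 : 0 < w.
  by rewrite ltr_pwDl ?mulr_ge0 // ?ln_ge0 ?ler1n // ltr_pwDl.
have ln2 : 0 < ln 2 :> R by rewrite ln_gt0 // ltr1n.
exists (expR (- 1)), (w / ln 2); split; first exact: expR_gt0.
split; first exact: divr_gt0.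
move=> eps eps_gt0 eps_lt n n_gt0 N.
pose L := ln (1 / eps).
have epsE : eps = expR (- L) by rewrite /L div1r lnV ?posrE // opprK lnK.
have L1 : 1 <= L by move: eps_lt; rewrite epsE ltr_expR; lra.
have eps1 : eps <= 1.
  by rewrite (le_trans (ltW eps_lt)) // -[leRHS]expR0 ler_expR; lra.
pose nmax := (\max_(j < d) n j)%N.
have nmax_gt0 : 0 < nmax%:R :> R.
  by rewrite ltr0n (leq_trans (n_gt0 (Ordinal d_gt0))) // leq_bigmax.
have epsN0 : 0 <= eps * N%:R by rewrite mulr_ge0 // ltW.
have rate0 : 0 <= eps * N%:R / nmax%:R by rewrite divr_ge0 // ltW.
(* As [k] and [K] in the counting bound are integers, the real bounds on the rank and
   on the number of mismatches are rounded down. *)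
pose r := Num.truncn (eps * N%:R / nmax%:R).
pose K := Num.truncn (eps * N%:R).
have card_bad : #|near_low_rank (R := R) n r K|%:R
    <= 2 `^ (N%:R * (w / ln 2) * eps * L).
  have -> : 2 `^ (N%:R * (w / ln 2) * eps * L) = expR (N%:R * eps * L * w).
    rewrite /powR pnatr_eq0 /=; congr expR; rewrite -/w.
    have ln2N0 : ln 2 != 0 :> R by rewrite gt_eqF.
    by field.
  apply: near_low_rank_bound => //; last by case/andP: (truncn_itv epsN0).
  have [rle _] := andP (truncn_itv rate0).
  apply: (@le_trans _ _ (r%:R * (d%:R * nmax%:R))).
    rewrite natrM ler_wpM2l // -natrM ler_nat.
    rewrite -[X in (X * _)%N]card_ord -sum_nat_const leq_sum // => j _.
    exact: leq_bigmax.
  rewrite mulrCA -mulrA ler_wpM2l //.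
  by move: rle; rewrite ler_pdivlMr.
pose bad := near_low_rank (R := R) n r K.
pose S : {fset tensor R n} := [fset s in [seq sign_tensor n s | s <- enum (~: bad)]]%fset.
exists S; split=> [s|].
  rewrite inE => /mapP[p _ ->] i; rewrite ffunE.
  by case: (p i); [right|left].
split=> [|T].
  rewrite card_fseq undup_id ?map_inj_uniq ?enum_uniq //; last exact: sign_tensor_inj.
  rewrite size_map -cardE lerBlDr -lerBlDl.
  apply: le_trans card_bad; rewrite lerBlDl -natrX -natrD ler_nat.
  rewrite addnC cardsC card_ffun card_bool.
  rewrite card_dep_ffun foldrE big_map big_enum.
  by under eq_bigr do rewrite card_ord.
rewrite inE => /mapP[p pbad Tp].
move: pbad; rewrite mem_enum inE => pbad.
have [[i0 mi0] mle] := min_abs_entryP T n_gt0.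
have T_neq0 i : T i != 0.
  have := congr1 (fun F : tensor R n => F i) Tp; rewrite !ffunE -sgr_eq0 => ->.
  by case: (p i); rewrite ?oppr_eq0 oner_eq0.
have m0 : 0 < min_abs_entry T by rewrite mi0 normr_gt0.
apply: lb_le_inf.
  (* The set is not empty, as the zero tensor has rank 0. *)
  exists (l1norm (T - 0)), 0 => //=.
  have [_ /(_ 0%N) rk0] := tensor_rankP (0 : tensor R n) d_gt0.
  suff -> : tensor_rank (0 : tensor R n) = 0%N by [].
  apply/eqP; rewrite -leqn0; apply: rk0; exists (fun=> 0); split; first by case.
  by rewrite big_ord0.
move=> _ [T' /= T'r <-]; rewrite leNgt; apply/negP => close.
move/negP: pbad; apply; rewrite inE; apply/existsP.
exists [ffun i => 0 <= T' i]; apply/andP; split.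
  by rewrite inE; apply/asboolP; exists T' => //; rewrite truncn_ge_nat.
rewrite truncn_ge_nat // -(ler_pM2r m0).
apply: le_trans (ltW close).
apply: mismatch_le_l1norm => //; exact: ltW.
Qed.
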